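(* Let $\gamma\geq 1$ be a constant. Let $r\geq \gamma$ and $p_1,\ldots,p_r$ be positive integers, and let $\Delta:=\prod_{i=1}^r \Delta_{p_i}$. For every $\gamma$-anti-concentrated function $f:\Delta\to\mathbb{R}$, if $x$ is sampled from the uniform distribution on $\Delta$, then $$\Pr\left[f(x)\geq (\gamma e^2)^{-r}\cdot \prod_{i=1}^r \frac{1}{p_i}\cdot \mathrm{OPT}\right]\geq \frac{1}{e^{\gamma}\log r},$$ where $\mathrm{OPT}:=\max\{f(z): z\in \Delta\}$.
   Context: $\Delta_d:=\{x\in\mathbb{R}^d: \sum_{i=1}^d x_i=1,\ x\geq 0\}$ denotes the standard $(d-1)$-simplex; the uniform distribution on $\Delta_d$ is the normalized $(d-1)$-dimensional Lebesgue measure on it, and the uniform distribution on a product of simplices is the product of these measures. For $\gamma\geq 1$, a nonnegative measurable function $g:\Delta_d\to\mathbb{R}$ is called $\gamma$-anti-concentrated if for every $c\in(0,1)$, $\Pr[g(x)\geq c\cdot \max_{z\in\Delta_d} g(z)]\geq 1-\gamma d c$, where $x$ is uniform on $\Delta_d$. A nonnegative (measurable) function $f:\prod_{i=1}^r\Delta_{p_i}\to\mathbb{R}$ is called $\gamma$-anti-concentrated if for every coordinate $i\in\{1,\ldots,r\}$ and every choice of $a_j\in\Delta_{p_j}$ for $j\neq i$, the function $x\mapsto f(a_1,\ldots,a_{i-1},x,a_{i+1},\ldots,a_r)$ on $\Delta_{p_i}$ is $\gamma$-anti-concentrated. *)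

(* Defs.v *)
From HB Require Import structures.
From mathcomp Require Import all_boot all_order all_algebra.
From mathcomp Require Import all_classical all_reals all_analysis.

Set Implicit Arguments.
Unset Strict Implicit.
Unset Printing Implicit Defensive.

Import Order.TTheory GRing.Theory Num.Theory.
Import numFieldNormedType.Exports.

Local Open Scope classical_set_scope.
Local Open Scope ring_scope.

Definition is_max (R : realType) (A : set R) (M : R) : Prop :=
  A M /\ ubound A M.

Section lebesgue_tuple.
Context {R : realType}.

Definition cons_pair n (z : measurableTypeR R * n.-tuple R) : n.+1.-tuple R :=
  [tuple of z.1 :: z.2].

Lemma measurable_cons_pair n : measurable_fun setT (@cons_pair n).
Proof. by apply: measurable_cons. Qed.

Definition uncons_pair n (t : n.+1.-tuple R) : measurableTypeR R * n.-tuple R :=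
  (thead t, [tuple of behead t]).

Lemma measurable_uncons_pair n : measurable_fun setT (@uncons_pair n).
Proof.
apply/measurable_fun_pair; first exact: measurable_tnth.
exact: measurable_behead.
Qed.

Lemma cons_pairK n : cancel (@cons_pair n) (@uncons_pair n).
Proof. by move=> [x t]; congr pair; apply: val_inj. Qed.

Section step.
Context n (mu : {sigma_finite_measure set (n.-tuple R) -> \bar R}).

Definition lebesgue_tupleS : set (n.+1.-tuple R) -> \bar R :=
  pushforward (@lebesgue_measure R \x mu)%E (@cons_pair n).

Let lebesgue_tupleS0 : lebesgue_tupleS set0 = 0%E.
Proof. by rewrite /lebesgue_tupleS /pushforward preimage_set0 measure0. Qed.

Let lebesgue_tupleS_ge0 A : (0 <= lebesgue_tupleS A)%E.
Proof. by rewrite /lebesgue_tupleS /pushforward measure_ge0. Qed.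

Let lebesgue_tupleS_sigma_additive : semi_sigma_additive lebesgue_tupleS.
Proof. by apply: measure_semi_sigma_additive; exact: measurable_cons_pair. Qed.

HB.instance Definition _ := isMeasure.Build _ _ _ lebesgue_tupleS
  lebesgue_tupleS0 lebesgue_tupleS_ge0 lebesgue_tupleS_sigma_additive.

Let lebesgue_tupleS_sigma_finite : sigma_finite setT lebesgue_tupleS.
Proof.
have /sigma_finiteP[F [TF ndF Foo]] := sigma_finiteT (@lebesgue_measure R).
have /sigma_finiteP[G [TG ndG Goo]] := sigma_finiteT mu.
exists (fun k => @uncons_pair n @^-1` (F k `*` G k)).
  rewrite -preimage_bigcup (_ : \bigcup_k _ = setT) ?preimage_setT//.
  rewrite -setXTT TF TG predeqE => -[x y]; split.
    by move=> [k _ []/= ? ?]; split; exists k.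
  move=> [/= [k _ Fkx] [l _ Gly]]; exists (maxn k l) => //; split.
  - by move: x Fkx; exact/subsetPset/ndF/leq_maxl.
  - by move: y Gly; exact/subsetPset/ndG/leq_maxr.
move=> k; have [mF Fk] := Foo k; have [mG Gk] := Goo k; split.
  rewrite -[X in measurable X]setTI.
  by apply: measurable_uncons_pair => //; exact: measurableX.
rewrite /lebesgue_tupleS /pushforward -comp_preimage.
rewrite (_ : _ \o _ = id) ?preimage_id; last exact/funext/cons_pairK.
by rewrite product_measure1E// lte_mul_pinfty// ge0_fin_numE.
Qed.

HB.instance Definition _ := Measure_isSigmaFinite.Build _ _ _ lebesgue_tupleS
  lebesgue_tupleS_sigma_finite.

End step.

Fixpoint lebesgue_tuple n : {sigma_finite_measure set (n.-tuple R) -> \bar R} :=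
  if n is m.+1 then lebesgue_tupleS (lebesgue_tuple m) else \d_[tuple].

End lebesgue_tuple.

Section simplex.
Context {R : realType}.

Definition simplex d : set (d.-tuple R) :=
  [set x | \sum_(i < d) tnth x i = 1 /\ forall i, 0 <= tnth x i].
Arguments simplex d : clear implicits.

Lemma measurable_simplex d : measurable (simplex d).
Proof.
have -> : simplex d = [set x | \sum_(i < d) tnth x i = 1] `&`
    \bigcap_(i in [set: 'I_d]) [set x : d.-tuple R | 0 <= tnth x i].
  by apply/seteqP; split=> x [? x0]; split=> // i; have := x0 i; exact.
apply: measurableI.
  rewrite -[X in measurable X]setTI.
  have : measurable_fun setT (fun x : d.-tuple R => \sum_(i < d) tnth x i).
    by apply: measurable_sum => i; exact: measurable_tnth.
  by move=> /(_ measurableT [set 1]); apply.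
apply: fin_bigcap_measurable => // i _.
rewrite (_ : mkset _ = (tnth (T:=R))^~ i @^-1` `[0, +oo[); last first.
  by apply/seteqP; split => x /=; rewrite in_itv/= andbT.
by rewrite -[X in measurable X]setTI; apply: measurable_tnth.
Qed.

Definition simplex_chart n (y : n.-tuple R) : n.+1.-tuple R :=
  [tuple of (1 - \sum_(i < n) tnth y i) :: y].

Lemma measurable_simplex_chart n : measurable_fun setT (@simplex_chart n).
Proof.
apply: measurable_cons => //; apply: measurable_realfun.measurable_funB => //.
by apply: measurable_sum => i; exact: measurable_tnth.
Qed.

(* Lebesgue measure of the hyperplane [\sum_i x_i = 1] of R^d, up to the
   constant factor [Num.sqrt d%:R] which the normalisation below cancels. *)
Definition lebesgue_hyperplane d : set (d.-tuple R) -> \bar R :=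
  if d is n.+1 then pushforward (lebesgue_tuple n) (@simplex_chart n)
  else mzero.

Section hyperplane_measure.
Variable d : nat.

Let hyperplane0 : lebesgue_hyperplane (set0 : set (d.-tuple R)) = 0%E.
Proof.
by case: d => [|n]//=; rewrite /pushforward preimage_set0 measure0.
Qed.

Let hyperplane_ge0 (A : set (d.-tuple R)) : (0 <= lebesgue_hyperplane A)%E.
Proof. by case: d A => [|n] A //=; rewrite /pushforward measure_ge0. Qed.

Let hyperplane_sigma_additive : semi_sigma_additive (@lebesgue_hyperplane d).
Proof.
case: d => [|n]; first exact: measure_semi_sigma_additive.
by apply: measure_semi_sigma_additive; exact: measurable_simplex_chart.
Qed.

HB.instance Definition _ := isMeasure.Build _ _ _ (@lebesgue_hyperplane d)
  hyperplane0 hyperplane_ge0 hyperplane_sigma_additive.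

End hyperplane_measure.

Let box n (a : R) : set (n.-tuple R) := [set y | forall i, 0 <= tnth y i <= a].

Let measurable_box n a : measurable (@box n a).
Proof.
have -> : box a =
    \bigcap_(i in [set: 'I_n]) [set x : n.-tuple R | 0 <= tnth x i <= a].
  by apply/seteqP; split=> x x0 i; have := x0 i; exact.
apply: fin_bigcap_measurable => // i _.
rewrite (_ : mkset _ = (tnth (T:=R))^~ i @^-1` `[0, a]); last first.
  by apply/seteqP; split => x /=; rewrite in_itv.
by rewrite -[X in measurable X]setTI; apply: measurable_tnth.
Qed.

Let lebesgue_box n (a : R) : 0 <= a -> lebesgue_tuple n (box a) = (a ^+ n)%:E.
Proof.
move=> a0; elim: n => [|n ih] /=.
  by rewrite diracE mem_set// => -[].
rewrite /lebesgue_tupleS /pushforward.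
rewrite (_ : _ @^-1` _ = `[0, a] `*` @box n a).
  transitivity (@lebesgue_measure R `[0%R, a] * lebesgue_tuple n (box a))%E.
    apply: (@product_measure1E _ _ _ _ R (@lebesgue_measure R)).
      exact: measurable_itv.
    exact: measurable_box.
  rewrite ih lebesgue_measure_itv/= lte_fin.
  case: ltP => [_|a0']; first by rewrite oppr0 addr0 -EFinM -exprS.
  have -> : a = 0 by apply/le_anti; rewrite a0 a0'.
  by rewrite mul0e expr0n.
apply/seteqP; split => [[x t] /= h|[x t] /= [+ h] i].
  split; first by have := h ord0; rewrite in_itv.
  by move=> i; have := h (lift ord0 i); rewrite tnthS.
rewrite in_itv/= => hx; case: (unliftP ord0 i) => [j ->|-> //].
by rewrite tnthS; exact: h.
Qed.

Lemma simplex_chartE n :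
  @simplex_chart n @^-1` simplex n.+1 =
  [set y | \sum_(i < n) tnth y i <= 1 /\ forall i, 0 <= tnth y i].
Proof.
apply/seteqP; split => [y [_ h]|y [y1 h]].
  split=> [|i]; first by have := h ord0; rewrite subr_ge0.
  by have := h (lift ord0 i); rewrite tnthS.
split.
  rewrite big_ord_recl/=; under eq_bigr do rewrite tnthS.
  exact: subrK.
move=> i; case: (unliftP ord0 i) => [j ->|->]; first by rewrite tnthS.
by rewrite subr_ge0.
Qed.

Lemma lebesgue_simplex_lty d : (lebesgue_hyperplane (simplex d) < +oo)%E.
Proof.
case: d => [|n]; first by rewrite /= /mzero.
have : (lebesgue_tuple n (@box n 1) < +oo)%E by rewrite lebesgue_box// ltry.
apply: le_lt_trans; rewrite /= /pushforward; apply: le_measure => //.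
- rewrite inE -[X in measurable X]setTI; apply: measurable_simplex_chart => //.
  exact: measurable_simplex.
- by rewrite inE; exact: measurable_box.
- rewrite simplex_chartE => y [y1 y0] i; rewrite y0/= (le_trans _ y1)//.
  by rewrite (bigD1 i)//= lerDl sumr_ge0.
Qed.

Lemma lebesgue_simplex_gt0 d :
  (0 < d)%N -> (0 < lebesgue_hyperplane (simplex d))%E.
Proof.
case: d => [//|n _].
have : (0 < lebesgue_tuple n (@box n n.+1%:R^-1))%E.
  by rewrite lebesgue_box// lte_fin exprn_gt0.
move=> /lt_le_trans; apply; rewrite /= /pushforward; apply: le_measure => //.
- by rewrite inE; exact: measurable_box.
- rewrite inE -[X in measurable X]setTI; apply: measurable_simplex_chart => //.
  exact: measurable_simplex.
- rewrite simplex_chartE => y yb; split; last by move=> i; case/andP: (yb i).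
  apply: (@le_trans _ _ (\sum_(i < n) n.+1%:R^-1)).
    by apply: ler_sum => i _; case/andP: (yb i).
  rewrite sumr_const card_ord -[_ *+ n]mulr_natr mulrC ler_pdivrMr//.
  by rewrite mul1r ler_nat.
Qed.

(* The fallback [\d_point] of [mnormalize] is only used for [d = 0]: see
   [lebesgue_simplex_gt0] and [lebesgue_simplex_lty]. *)
Definition uniform_simplex d : probability (d.-tuple R) R :=
  mnormalize (mrestr (@lebesgue_hyperplane d) (@measurable_simplex d))
    \d_point.

Lemma uniform_simplexE d (A : set (d.-tuple R)) : (0 < d)%N ->
  uniform_simplex d A = (lebesgue_hyperplane (A `&` simplex d) *
    (fine (lebesgue_hyperplane (simplex d)))^-1%:E)%E.
Proof.
move=> d0.
have e : mrestr (@lebesgue_hyperplane d) (@measurable_simplex d) setT =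
  lebesgue_hyperplane (simplex d) by rewrite /mrestr setTI.
rewrite /uniform_simplex /= /mnormalize /= e.
rewrite gt_eqF ?lebesgue_simplex_gt0//=.
by rewrite lt_eqF// lebesgue_simplex_lty.
Qed.

End simplex.
Arguments simplex {R} d.

Definition dprod n (T : 'I_n -> Type) := forall i, T i.

Definition dprod_display : measure_display -> measure_display.
Proof. exact. Qed.

Section measurable_dprod.
Context {disp : measure_display} n (T : 'I_n -> measurableType disp).

HB.instance Definition _ := Pointed.copy (dprod T) (forall i, T i).

Definition g_sigma_dprod : set (set (dprod T)) :=
  <<s \bigcup_i preimage_set_system setT (fun x : dprod T => x i) measurable >>.

Let dprod_set0 : g_sigma_dprod set0.
Proof. exact: sigma_algebra0. Qed.

Let dprod_setC A : g_sigma_dprod A -> g_sigma_dprod (~` A).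
Proof. exact: sigma_algebraC. Qed.

Let dprod_bigcup (F : (set (dprod T))^nat) :
  (forall i, g_sigma_dprod (F i)) -> g_sigma_dprod (\bigcup_i (F i)).
Proof. exact: sigma_algebra_bigcup. Qed.

HB.instance Definition _ := @isMeasurable.Build (dprod_display disp)
  (dprod T) g_sigma_dprod dprod_set0 dprod_setC dprod_bigcup.

Lemma measurable_dprod_proj i : measurable_fun setT (fun x : dprod T => x i).
Proof.
move=> _ Y mY; rewrite setTI; apply: sub_sigma_algebra.
by exists i => //; exists Y => //; rewrite setTI.
Qed.

Lemma measurable_fun_dprod d' (S : measurableType d') (g : S -> dprod T) :
  (forall i, measurable_fun setT (fun s => g s i)) -> measurable_fun setT g.
Proof.
move=> mg _ Y mY; rewrite setTI.
have : preimage_set_system setT g g_sigma_dprod (g @^-1` Y).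
  by exists Y => //; rewrite setTI.
rewrite /g_sigma_dprod -g_sigma_preimageE.
apply: smallest_sub; first exact: sigma_algebra_measurable.
move=> _ [_ [i _ [B mB <-]] <-]; rewrite !setTI.
by rewrite -[X in measurable X]setTI; exact: (mg i).
Qed.

End measurable_dprod.

Section product_probability.
Context {disp : measure_display} {R : realType}.

Definition dcons n (T : 'I_n.+1 -> Type)
    (z : T ord0 * dprod (fun i : 'I_n => T (lift ord0 i))) : dprod T :=
  fun i => match unliftP ord0 i with
           | UnliftSome j e => ecast i (T i) (esym e) (z.2 j)
           | UnliftNone e => ecast i (T i) (esym e) z.1
           end.

Lemma dcons0 n (T : 'I_n.+1 -> Type) z : @dcons n T z ord0 = z.1.
Proof.
rewrite /dcons; case: unliftP => [j e|e].
  by exfalso; have := neq_lift ord0 j; rewrite -e eqxx.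
by rewrite (eq_irrelevance e erefl).
Qed.

Lemma dcons_lift n (T : 'I_n.+1 -> Type) z j :
  @dcons n T z (lift ord0 j) = z.2 j.
Proof.
rewrite /dcons; case: unliftP => [k e|e].
  have ekj := lift_inj e; subst k.
  by rewrite (eq_irrelevance e erefl).
by exfalso; have := neq_lift ord0 j; rewrite e eqxx.
Qed.

Lemma measurable_dcons n (T : 'I_n.+1 -> measurableType disp) :
  measurable_fun setT (@dcons n T).
Proof.
apply: measurable_fun_dprod => i.
case: (unliftP ord0 i) => [j ->|->].
  rewrite (_ : (fun _ => _) = (fun z => z.2 j)); last first.
    by apply/funext => z; rewrite dcons_lift.
  exact: (measurableT_comp
    (@measurable_dprod_proj _ _ (fun i : 'I_n => T (lift ord0 i)) j)
    measurable_snd).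
rewrite (_ : (fun _ => _) = fst)//.
by apply/funext => z; rewrite dcons0.
Qed.

Section step.
Context n (T : 'I_n.+1 -> measurableType disp) (P : probability (T ord0) R)
  (Q : probability (dprod (fun i : 'I_n => T (lift ord0 i))) R).

Definition product_probabilityS : set (dprod T) -> \bar R :=
  pushforward (P \x Q)%E (@dcons n T).

Let product_probabilityS0 : product_probabilityS set0 = 0%E.
Proof. by rewrite /product_probabilityS /pushforward preimage_set0 measure0. Qed.

Let product_probabilityS_ge0 A : (0 <= product_probabilityS A)%E.
Proof. by rewrite /product_probabilityS /pushforward measure_ge0. Qed.

Let product_probabilityS_sigma_additive :
  semi_sigma_additive product_probabilityS.
Proof. by apply: measure_semi_sigma_additive; exact: measurable_dcons. Qed.

HB.instance Definition _ := isMeasure.Build _ _ _ product_probabilityS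
  product_probabilityS0 product_probabilityS_ge0
  product_probabilityS_sigma_additive.

Let product_probabilityST : product_probabilityS setT = 1%E.
Proof.
by rewrite /product_probabilityS /pushforward preimage_setT probability_setT.
Qed.

HB.instance Definition _ := Measure_isProbability.Build _ _ _
  product_probabilityS product_probabilityST.

End step.

Fixpoint product_probability n :
  forall (T : 'I_n -> measurableType disp), (forall i, probability (T i) R) ->
    probability (dprod T) R :=
  if n is m.+1 then fun T P =>
    product_probabilityS (P ord0)
      (product_probability (fun i => P (lift ord0 i)))
  else fun T P => \d_point.

Lemma product_probabilityE n (T : 'I_n -> measurableType disp)
   (P : forall i, probability (T i) R) (A : forall i, set (T i)) :
  (forall i, measurable (A i)) ->
  product_probability P [set x | forall i, A i (x i)] =
  (\prod_(i < n) P i (A i))%E.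
Proof.
elim: n => [|n ih] in T P A *; move=> mA.
  by rewrite big_ord0 /= diracE mem_set// => -[].
rewrite big_ord_recl.
rewrite -(ih _ (fun i => P (lift ord0 i)) (fun i => A (lift ord0 i)))//=.
rewrite /product_probabilityS /pushforward -product_measure1E//; last first.
  rewrite (_ : mkset _ = \bigcap_(i in [set: 'I_n])
      ((fun x : dprod (fun i : 'I_n => T (lift ord0 i)) => x i) @^-1`
       (A (lift ord0 i)))); last first.
    by apply/seteqP; split=> x h i; have := h i; exact.
  apply: fin_bigcap_measurable => // i _.
  rewrite -[X in measurable X]setTI.
  have := @measurable_dprod_proj _ _ (fun i : 'I_n => T (lift ord0 i)) i measurableT.
  by move=> /(_ _ (mA (lift ord0 i))).
congr (_ _); apply/seteqP; split => [[x t] /= h|[x t] /= [hx h] i].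
  split; first by have := h ord0; rewrite dcons0.
  by move=> i; have := h (lift ord0 i); rewrite dcons_lift.
by case: (unliftP ord0 i) => [j ->|->]; rewrite ?dcons0 ?dcons_lift//; exact: h.
Qed.

End product_probability.

Section anti_concentration.
Context {R : realType}.

Definition simplex_prod r (p : 'I_r -> nat) :
    set (dprod (fun i => (p i).-tuple R)) :=
  [set x | forall i, simplex (p i) (x i)].
Arguments simplex_prod r p : clear implicits.

Definition uniform_simplex_prod r (p : 'I_r -> nat) :
    probability (dprod (fun i => (p i).-tuple R)) R :=
  product_probability (fun i => uniform_simplex (p i)).

(* A function on a simplex (or a product of simplices) is represented by a
   function on the ambient space, of which only the values there matter. *)
Definition simplex_anti_concentrated (gamma : R) d (g : d.-tuple R -> R) :=
  [/\ forall x, simplex d x -> 0 <= g x,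
      measurable_fun (simplex d) g &
      exists2 M, is_max (g @` simplex d) M &
        forall c : R, 0 < c < 1 ->
          ((1 - gamma * d%:R * c)%:E <=
           uniform_simplex d (simplex d `&` [set x | (c * M <= g x)%R]))%E].

(* [dfwith a i x] is [a] with its [i]-th coordinate replaced by [x]. *)
Definition anti_concentrated (gamma : R) r (p : 'I_r -> nat)
    (f : dprod (fun i => (p i).-tuple R) -> R) :=
  [/\ forall x, simplex_prod r p x -> 0 <= f x,
      measurable_fun (simplex_prod r p) f &
      forall (i : 'I_r) (a : dprod (fun i => (p i).-tuple R)),
        (forall j, j != i -> simplex (p j) (a j)) ->
        simplex_anti_concentrated gamma (fun x => f (dfwith a i x))].

End anti_concentration.
Arguments simplex_prod {R r} p.
Arguments uniform_simplex_prod {R r} p.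

(* Main.v *)
Require Import Defs.
From HB Require Import structures.
From mathcomp Require Import all_boot all_order all_algebra.
From mathcomp Require Import all_classical all_reals all_analysis.
From mathcomp Require Import measurable_realfun lra.

Import Order.TTheory GRing.Theory Num.Theory.
Import numFieldNormedType.Exports.

Local Open Scope classical_set_scope.
Local Open Scope ring_scope.

(** By induction on the number of factors, for every [z] in the product with
    [f z > 0] and every [tau > 0],
      Pr[f < tau] <= 2 ^ (r - 1) * sqrt (tau * \prod_i (gamma * p_i) / f z).
    For one factor this is anti-concentration together with
    [min 1 u <= sqrt u].  For the inductive step put [g x := f (x, z')], where
    [z'] are the last coordinates of [z].  By the induction hypothesis the
    probability [X x] of [f (x, _) < tau] is at most [K / sqrt (g x)], so
    anti-concentration of [g] gives the tail [Pr[X > t] <= (b / t) ^ 2], and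
    the layer-cake formula bounds the expectation of [X] by [2 * b].
    Taking [f z = OPT] makes the bad event have probability at most
    [2 ^ (r - 1) / e ^ r <= 2 / e ^ 2] when [r >= 2]; for [r = 1] the claimed
    lower bound is the junk value [1 / 0 = 0]. *)

(** * Expectation of a random variable with a quadratic tail *)

Lemma within_continuous_inv_sqr (R : realType) (b : R) : 0 < b ->
  {within `[b, +oo[, continuous (fun t : R => (b / t) ^+ 2)}.
Proof.
move=> b0; apply: continuous_in_subspaceT => x.
rewrite inE/= in_itv/= andbT => bx.
have x0 : x != 0 by rewrite gt_eqF// (lt_le_trans b0).
have c : {for x, continuous (fun t : R => b / t)}.
  by apply: cvgM; [exact: cvg_cst|exact: cvgV].
exact: (cvgM c c).
Qed.

(** The antiderivative [- b ^+ 2 * t^-1] equals [- b] at [b] and tends to [0] at infinity. *)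
Lemma integral_inv_sqr (R : realType) (b : R) : 0 < b ->
  (\int[lebesgue_measure]_(t in `[b, +oo[) ((b / t) ^+ 2)%:E)%E = b%:E.
Proof.
move=> b0.
have dF (x : R) : 0 < x ->
    is_derive x 1 (fun t => - b ^+ 2 * t^-1) ((b / x) ^+ 2).
  move=> x0; have x0' : x != 0 by rewrite gt_eqF.
  have dV : is_derive x 1 (fun t : R => t^-1) (- x ^- 2 *: 1).
    exact: is_deriveV.
  have := is_deriveZ (- b ^+ 2) dV.
  by rewrite {1 2}/GRing.scale/= mulr1 mulrNN expr_div_n.
rewrite (@ge0_continuous_FTC2y _ _ (fun t => - b ^+ 2 * t^-1) _ 0).
- rewrite expr2 mulNr -mulrA divff ?gt_eqF// mulr1 EFinN oppeK.
  by rewrite add0e.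
- by move=> x _; exact: sqr_ge0.
- exact: within_continuous_inv_sqr.
- rewrite -(mulr0 (- b ^+ 2)); apply: cvgM; first exact: cvg_cst.
  apply/(@gtr0_cvgV0 _ _ _ _ id); last exact: cvg_id.
  by near=> x.
- by move=> x bx; have := dF x (lt_trans b0 bx) => -[].
- apply: cvg_at_right_filter; apply: cvgM; first exact: cvg_cst.
  by apply: cvgV => //; rewrite gt_eqF.
- move=> x; rewrite in_itv/= andbT => bx.
  rewrite derive1E; have := dF x (lt_trans b0 bx) => dFx.
  exact: derive_val.
Unshelve. all: end_near. Qed.

(** The layer-cake integral is split at [b], where the tail bound reaches [1]: on [[0, b[] the tail
    is at most [1], on [[b, +oo[] it is at most [(b / t) ^+ 2], and each piece contributes at most
    [b]. *)
Lemma expectation_le_quadratic_tail d (T : measurableType d) (R : realType)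
    (P : probability T R) (X : {RV P >-> R}) (b : R) : 0 < b ->
  (forall x, 0 <= X x) ->
  (forall t : R, 0 < t -> (P [set x | (t < X x)%R] <= ((b / t) ^+ 2)%:E)%E) ->
  ('E_P[X] <= (2 * b)%:E)%E.
Proof.
move=> b0 X0 tailX; rewrite ge0_expectation_ccdf//.
have ccdfE t : ccdf X t = P [set x | t < X x].
  rewrite /ccdf /distribution /pushforward; congr (P _).
  by apply/seteqP; split => x /=; rewrite in_itv/= andbT.
have mccdf (D : set R) : measurable_fun D (ccdf X).
  by apply: measurable_funTS; exact: ccdf_measurable.
rewrite (_ : `[0, +oo[%classic = `[0, b[ `|` `[b, +oo[); last first.
  by apply: itv_bndbnd_setU; rewrite bnd_simp// ltW.
rewrite ge0_integral_setU//=; last 2 first.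
- exact: mccdf.
- apply/disj_setPS => t [] /=; rewrite !in_itv/= => /andP[_ tb].
  by rewrite andbT leNgt tb.
rewrite mulr_natl mulr2n EFinD; apply: leeD.
  have bE : (\int[lebesgue_measure]_(t in `[0%R, b[) cst 1 t = b%:E)%E.
    rewrite integral_cst//= mul1e lebesgue_measure_itv/= lte_fin b0.
    by rewrite oppr0 adde0.
  rewrite -[leRHS]bE; apply: ge0_le_integral => //.
  - exact: mccdf.
  - by move=> t _; exact: probability_le1.
rewrite -[leRHS](integral_inv_sqr _ _ b0); apply: ge0_le_integral => //.
- exact: mccdf.
- apply/measurable_EFinP; apply: subspace_continuous_measurable_fun => //.
  exact: within_continuous_inv_sqr.
- move=> t; rewrite /= in_itv/= andbT => bt; rewrite ccdfE.
  by apply: tailX; exact: lt_le_trans bt.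
Qed.

(** * Total mass of the simplices and small values on one simplex *)

Section simplex_lemmas.
Context {R : realType}.

Lemma uniform_simplex_simplex d : (0 < d)%N ->
  uniform_simplex d (simplex d : set (d.-tuple R)) = 1%E.
Proof.
move=> d0; rewrite uniform_simplexE// setIid.
have h0 := @lebesgue_simplex_gt0 R d d0.
have hy := @lebesgue_simplex_lty R d.
rewrite -[X in (X * _)%E]fineK ?ge0_fin_numE ?ltW//.
rewrite -EFinM divff// gt_eqF// fine_gt0//; exact/andP.
Qed.

Lemma measurable_simplex_prod r (p : 'I_r -> nat) :
  measurable (simplex_prod p : set (dprod (fun i => (p i).-tuple R))).
Proof.
rewrite (_ : simplex_prod p = \bigcap_(i in [set: 'I_r])
    ((fun x : dprod (fun i => (p i).-tuple R) => x i) @^-1`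
     simplex (p i))); last first.
  by apply/seteqP; split=> x h i; have := h i; exact.
apply: fin_bigcap_measurable => // i _; rewrite -[X in measurable X]setTI.
have := @measurable_dprod_proj _ _ (fun i : 'I_r => (p i).-tuple R) i.
by apply => //; exact: measurable_simplex.
Qed.

Lemma uniform_simplex_prod_simplex_prod r (p : 'I_r -> nat) :
  (forall i, (0 < p i)%N) ->
  uniform_simplex_prod p
    (simplex_prod p : set (dprod (fun i => (p i).-tuple R))) = 1%E.
Proof.
move=> p0; transitivity (\prod_(i < r)
    uniform_simplex (p i) (simplex (p i) : set ((p i).-tuple R)))%E.
  by apply: product_probabilityE => i; exact: measurable_simplex.
by rewrite big1// => i _; rewrite uniform_simplex_simplex.
Qed.

Lemma measurable_sub_lt d (T : measurableType d) (D : set T) (g : T -> R) s :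
  measurable D -> measurable_fun D g ->
  measurable (D `&` [set x | (g x < s)%R]).
Proof.
move=> mD mg; rewrite (_ : mkset _ = g @^-1` `]-oo, s[).
  exact: mg.
by apply/seteqP; split => x /=; rewrite in_itv.
Qed.

(** This is anti-concentration with [c = s / M], weakened from the maximum [M] to a value
    [g z <= M], since the induction will not supply maximisers. If [s >= M], this [c] is not
    admissible, but the right-hand side is then at least [1]. *)
Lemma simplex_anti_concentrated_lt (gamma : R) d (g : d.-tuple R -> R) z
    (s : R) :
  1 <= gamma -> (0 < d)%N -> simplex_anti_concentrated gamma g ->
  simplex d z -> 0 < g z -> 0 < s ->
  (uniform_simplex d (simplex d `&` [set x | (g x < s)%R]) <=
   (gamma * d%:R * s / g z)%:E)%E.
Proof.
move=> g1 d0 [gge0 mg [M [[y sy yM] Mub] anti]] sz gz0 s0.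
have gzM : g z <= M by apply: Mub; exists z.
have M0 : 0 < M := lt_le_trans gz0 gzM.
have gd1 : 1 <= gamma * d%:R by rewrite mulr_ege1// ler1n.
have gd0 : 0 <= gamma * d%:R by rewrite (le_trans _ gd1).
have msg := @measurable_sub_lt _ _ _ g s (@measurable_simplex R d) mg.
have le_quot : gamma * d%:R * (s / M) <= gamma * d%:R * s / g z.
  rewrite -[leRHS]mulrA ler_wpM2l// ler_wpM2l ?(ltW s0)//.
  by rewrite lef_pV2.
have [sM|Ms] := ltP s M; last first.
  apply: (le_trans (probability_le1 _ msg)); rewrite lee_fin.
  apply: le_trans le_quot; rewrite (le_trans gd1)// ler_peMr//.
  by rewrite ler_pdivlMr// mul1r.
have : 0 < s / M < 1 by rewrite divr_gt0//= ltr_pdivrMr// mul1r.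
move=> /anti; rewrite divfK ?gt_eqF// => antis.
rewrite (_ : _ `&` _ =
    simplex d `\` (simplex d `&` [set x | (s <= g x)%R])); last first.
  apply/seteqP; split => x /= [sx].
    by rewrite ltNge => /negP gx; split => // -[].
  move=> h; split => //; rewrite ltNge; apply/negP => ?; exact: h.
have mge : measurable (simplex d `&` [set x | (s <= g x)%R]).
  rewrite (_ : mkset _ = g @^-1` `[s, +oo[).
    by apply: mg => //; exact: measurable_simplex.
  by apply/seteqP; split => x /=; rewrite in_itv/= andbT.
rewrite measureD//; [|exact: measurable_simplex|].
  rewrite setIA setIid [X in (X - _ <= _)%E](_ : _ = 1%E); last first.
    exact: uniform_simplex_simplex.
  rewrite (@le_trans _ _ (gamma * d%:R * (s / M))%:E)%E ?lee_fin//.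
  rewrite leeBlDr ?fin_num_measure//.
  by rewrite -leeBlDl// -EFinB.
rewrite (le_lt_trans (probability_le1 _ _)) ?ltry//.
exact: measurable_simplex.
Qed.

End simplex_lemmas.

(** * Splitting a point into its first and remaining coordinates *)

Section dcons_lemmas.
Context n (T : 'I_n.+1 -> Type).
Implicit Types (x : T ord0) (y : dprod (fun i : 'I_n => T (lift ord0 i))).

Lemma dcons_eta (z : dprod T) :
  dcons (z ord0, (fun i => z (lift ord0 i)) : dprod _) = z.
Proof.
apply: functional_extensionality_dep => i.
by case: (unliftP ord0 i) => [j ->|->]; rewrite ?dcons0 ?dcons_lift.
Qed.

Lemma dfwith_dcons0 x y x' : dfwith (dcons (x, y)) ord0 x' = dcons (x', y).
Proof.
apply: functional_extensionality_dep => i.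
case: (unliftP ord0 i) => [j ->|->]; last by rewrite dfwithin dcons0.
by rewrite dfwithout ?neq_lift// !dcons_lift.
Qed.

Lemma dfwith_dcons_lift x y i (yi : T (lift ord0 i)) :
  dfwith (dcons (x, y)) (lift ord0 i) yi = dcons (x, dfwith y i yi : dprod _).
Proof.
apply: functional_extensionality_dep => k.
case: (unliftP ord0 k) => [j ->|->]; last first.
  by rewrite dfwithout 1?eq_sym ?neq_lift// !dcons0.
rewrite dcons_lift/=; have [<-|ij] := eqVneq i j; first by rewrite !dfwithin.
by rewrite !dfwithout ?(inj_eq lift_inj)// dcons_lift.
Qed.

End dcons_lemmas.

(** * Slices of an anti-concentrated function on a product *)

Section slices.
Context {R : realType} (gamma : R) (r : nat) (p : 'I_r.+1 -> nat).
Let p' i := p (lift ord0 i).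
Let T := dprod (fun i : 'I_r.+1 => (p i).-tuple R).
Let T' := dprod (fun i : 'I_r => (p' i).-tuple R).
Implicit Types (f : T -> R) (x : (p ord0).-tuple R) (y : T').

Lemma simplex_prod_dcons x y :
  simplex_prod p (dcons (x, y) : T) <-> simplex (p ord0) x /\ simplex_prod p' y.
Proof.
split=> [h|[hx hy] i].
  split; first by have := h ord0; rewrite dcons0.
  by move=> i; have := h (lift ord0 i); rewrite dcons_lift.
case: (unliftP ord0 i) => [j ->|->]; first by rewrite dcons_lift; exact: hy.
by rewrite dcons0.
Qed.

Lemma measurable_dcons_preimage (B : set T) : measurable B ->
  measurable (@dcons r (fun i => (p i).-tuple R) @^-1` B).
Proof.
move=> mB; rewrite -[X in measurable X]setTI.
exact: (@measurable_dcons _ r (fun i => (p i).-tuple R)).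
Qed.

(** A one-coordinate slice of [f (x, _)] in direction [i] is the slice of [f] in direction
    [lift ord0 i] through a point starting with [x]. *)
Lemma anti_concentrated_dcons f x : simplex (p ord0) x ->
  anti_concentrated gamma f ->
  anti_concentrated gamma (fun y : T' => f (dcons (x, y) : T)).
Proof.
move=> sx [f0 mf af]; split.
- by move=> y sy; apply: f0; apply/simplex_prod_dcons.
- apply: (measurable_comp _ _ mf (g := fun y : T' => dcons (x, y) : T)).
  + exact: measurable_simplex_prod.
  + by move=> _ [y sy <-]; apply/simplex_prod_dcons.
  + apply: measurable_funTS; 
    apply: (measurableT_comp (f := @dcons r (fun i => (p i).-tuple R))
                             (g := pair x)).
      exact: (@measurable_dcons _ r (fun i => (p i).-tuple R)).
    exact: pair1_measurable.
- move=> i a ha.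
  rewrite (_ : (fun _ => _) =
      (fun t => f (dfwith (dcons (x, a) : T) (lift ord0 i) t))).
    apply: af => j; case: (unliftP ord0 j) => [k ->|-> _]; last first.
      by rewrite dcons0.
    by rewrite (inj_eq lift_inj) => /ha; rewrite dcons_lift.
  by apply/funext => t; rewrite dfwith_dcons_lift.
Qed.

Lemma anti_concentrated_dcons0 f y : simplex_prod p' y ->
  anti_concentrated gamma f ->
  simplex_anti_concentrated gamma (fun x => f (dcons (x, y) : T)).
Proof.
(* The zero tuple is a placeholder: [dfwith] overwrites coordinate [ord0], and only the other
   coordinates must lie in their simplices. *)
move=> sy [_ _ /(_ ord0 (dcons ([tuple of nseq (p ord0) 0], y) : T))].
rewrite (_ : (fun x => f (dfwith _ _ _)) = fun x => f (dcons (x, y))).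
  apply=> j; case: (unliftP ord0 j) => [k ->|->]; last by rewrite eqxx.
  by rewrite dcons_lift => _; exact: sy.
by apply/funext => x; rewrite dfwith_dcons0.
Qed.

End slices.

(** * Probability of small values on a product of simplices *)

Section small_values.
Context {R : realType} (gamma : R) (gamma_ge1 : 1 <= gamma).

Let gammaM_gt0 n : (0 < n)%N -> 0 < gamma * n%:R.
Proof.
by move=> n0; rewrite mulr_gt0 ?ltr0n// (lt_le_trans ltr01).
Qed.

(** The inductive step, with [K] standing for the part of the bound on the last [r] factors that
    does not depend on [x]. Integrating the section probabilities over the first factor costs the
    factor [2] of the quadratic tail lemma. *)
Lemma uniform_simplex_prodS_lt r (p : 'I_r.+1 -> nat)
    (f : dprod (fun i => (p i).-tuple R) -> R) z (tau K : R) :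
  (forall i, (0 < p i)%N) -> anti_concentrated gamma f ->
  simplex_prod p z -> 0 < f z -> 0 < K ->
  (forall x, simplex (p ord0) x ->
     let fx y := f (dcons (x, y) : dprod (fun i => (p i).-tuple R)) in
     0 < fx (fun i => z (lift ord0 i)) ->
     (uniform_simplex_prod (fun i => p (lift ord0 i))
       (simplex_prod (fun i => p (lift ord0 i)) `&` [set y | (fx y < tau)%R])
      <= (K / Num.sqrt (fx (fun i => z (lift ord0 i))))%:E)%E) ->
  (uniform_simplex_prod p (simplex_prod p `&` [set x | (f x < tau)%R]) <=
   (2 * (K * Num.sqrt (gamma * (p ord0)%:R / f z)))%:E)%E.
Proof.
move=> p0 af sz fz0 K0 ih.
have gp0 := gammaM_gt0 _ (p0 ord0).
set B := _ `&` _.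
have mB : measurable B.
  case: af => _ mf _; apply: measurable_sub_lt => //.
  exact: measurable_simplex_prod.
pose P := @uniform_simplex R (p ord0).
pose Q := @uniform_simplex_prod R r (fun i => p (lift ord0 i)).
pose E := @dcons r (fun i => (p i).-tuple R) @^-1` B.
have mE : measurable E by exact: measurable_dcons_preimage.
have fQ x : Q (xsection E x) \is a fin_num.
  by apply: fin_num_measure; exact: measurable_xsection.
have mX : measurable_fun setT (fun x => fine (Q (xsection E x))).
  apply: measurableT_comp; first exact: fine_measurable.
  exact: (measurable_fun_xsection Q mE).
(* True by unfolding: the product probability is the pushforward of [P \x Q] along [dcons], and
   [P \x Q] integrates the measures of sections. *)
have UE : uniform_simplex_prod p B = (\int[P]_x Q (xsection E x))%E by [].
pose X : {RV P >-> R} := mfun_Sub (mem_set mX).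
have -> : uniform_simplex_prod p B = ('E_P[X])%E.
  rewrite UE unlock; apply: eq_integral => x _.
  by rewrite /X/= fineK.
apply: expectation_le_quadratic_tail.
- by rewrite mulr_gt0// sqrtr_gt0 divr_gt0.
- by move=> x; rewrite /X/= fine_ge0.
move=> t t0.
pose z' : dprod (fun i : 'I_r => (p (lift ord0 i)).-tuple R) :=
  fun i => z (lift ord0 i).
pose g x := f (dcons (x, z') : dprod (fun i => (p i).-tuple R)).
have sz' : simplex_prod (fun i => p (lift ord0 i)) z' by move=> i; exact: sz.
have gz : g (z ord0) = f z by rewrite /g dcons_eta.
have ag : simplex_anti_concentrated gamma g by exact: anti_concentrated_dcons0.
(* The level [(K / t) ^+ 2] is the value of [g x] at which [K / sqrt (g x)] equals [t], so [X x > t]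
   will force [g x] below it. *)
have := @simplex_anti_concentrated_lt R gamma (p ord0) g (z ord0) ((K / t) ^+ 2)
  gamma_ge1 (p0 ord0) ag (sz ord0).
rewrite gz => /(_ fz0).
rewrite exprn_gt0 ?divr_gt0// => /(_ isT) le_g.
have -> : (K * Num.sqrt (gamma * (p ord0)%:R / f z) / t) ^+ 2 =
    gamma * (p ord0)%:R * (K / t) ^+ 2 / f z.
  rewrite !exprMn sqr_sqrtr; last by rewrite ltW// divr_gt0.
  by rewrite mulrAC [RHS]mulrAC mulrC.
apply: le_trans le_g; apply: le_measure; rewrite ?inE.
- rewrite (_ : mkset _ = X @^-1` `]t, +oo[); last first.
    by apply/seteqP; split => x /=; rewrite in_itv/= andbT.
  by rewrite -[Y in measurable Y]setTI; exact: measurable_funP.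
- case: ag => _ mg _; apply: measurable_sub_lt => //.
  exact: measurable_simplex.
move=> x /= tX.
(* Off the first simplex the section of [E] is empty, so [X x = 0] cannot exceed [t]. *)
have sx : simplex (p ord0) x.
  apply: contrapT => nsx; move: tX.
  rewrite (_ : xsection E x = set0) ?measure0/= ?ltNge ?ltW//.
  apply/seteqP; split => // y; rewrite /xsection/= inE.
  move=> [/simplex_prod_dcons].
  by case.
(* If [g x >= (K / t) ^+ 2], the hypothesis on sections gives [X x <= K / sqrt (g x) <= t], a
   contradiction. *)
split=> //; rewrite ltNge; apply/negP => gx.
have gx0 : 0 < g x by rewrite (lt_le_trans _ gx)// exprn_gt0// divr_gt0.
have := ih x sx gx0; rewrite leNgt => /negP; apply.
have -> : simplex_prod (fun i => p (lift ord0 i)) `&`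
    [set y | f (dcons (x, y) : dprod (fun i => (p i).-tuple R)) < tau] =
    xsection E x.
  apply/seteqP; split => y; rewrite /xsection/= inE /E/B/=.
    by move=> [sy fy]; split => //; apply/simplex_prod_dcons.
  by move=> [/simplex_prod_dcons[_ sy] fy].
rewrite -[ltRHS]fineK// lte_fin; apply: le_lt_trans tX.
rewrite ler_pdivrMr ?sqrtr_gt0// mulrC -ler_pdivrMr//.
have Kt0 : 0 <= K / t by rewrite divr_ge0// ltW.
by rewrite -(ger0_norm Kt0) -sqrtr_sqr ler_sqrt// ltW.
Qed.

(** The point [z] is arbitrary because, even if [z] maximises [f], its last coordinates need not
    maximise [f (x, _)] for other [x]. There are [r.+1] factors, so the exponent [r] counts the
    inductive steps. *)
Lemma uniform_simplex_prod_lt r (p : 'I_r.+1 -> nat)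
    (f : dprod (fun i => (p i).-tuple R) -> R) z (tau : R) :
  (forall i, (0 < p i)%N) -> anti_concentrated gamma f ->
  simplex_prod p z -> 0 < f z -> 0 < tau ->
  (uniform_simplex_prod p (simplex_prod p `&` [set x | (f x < tau)%R]) <=
   (2 ^+ r *
    Num.sqrt (tau * (\prod_(i < r.+1) (gamma * (p i)%:R)) / f z))%:E)%E.
Proof.
elim: r => [|r ih] in p f z *; move=> p0 af sz fz0 tau0.
  (* A product over ['I_0] has a single point, so [f] is determined by its first coordinate through
     [g]. *)
  pose z' : dprod (fun i : 'I_0 => (p (lift ord0 i)).-tuple R) :=
    fun i => z (lift ord0 i).
  pose g x := f (dcons (x, z') : dprod (fun i => (p i).-tuple R)).
  have gz : g (z ord0) = f z by rewrite /g dcons_eta.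
  have ag : simplex_anti_concentrated gamma g.
    by apply: anti_concentrated_dcons0 => // -[].
  have mg : measurable (simplex (p ord0) `&` [set x | g x < tau]).
    case: ag => _ mg _; apply: measurable_sub_lt => //.
    exact: measurable_simplex.
  rewrite expr0 mul1r big_ord_recl big_ord0 mulr1.
  have := @simplex_anti_concentrated_lt R gamma (p ord0) g (z ord0) tau
    gamma_ge1 (p0 ord0) ag (sz ord0).
  rewrite gz => /(_ fz0 tau0).
  rewrite [_ * tau]mulrC; set u := (X in X%:E) => le_u.
  have u0 : 0 < u by rewrite divr_gt0// mulr_gt0// gammaM_gt0.
  apply: (@le_trans _ _
    (uniform_simplex (p ord0) (simplex (p ord0) `&` [set x | (g x < tau)%R]))).
    set B := _ `&` _; set A := _ `&` _.
    pose P := @uniform_simplex R (p ord0).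
    pose Q := @uniform_simplex_prod R 0 (fun i => p (lift ord0 i)).
    have -> : uniform_simplex_prod p B =
        (P \x Q)%E (@dcons 0 (fun i => (p i).-tuple R) @^-1` B) by [].
    have -> : P A = (P \x Q)%E (A `*` setT).
      by rewrite product_measure1E// [X in (_ * X)%E]probability_setT mule1.
    apply: le_measure; rewrite ?inE.
    - apply: measurable_dcons_preimage; case: af => _ mf _.
      by apply: measurable_sub_lt => //; exact: measurable_simplex_prod.
    - exact: measurableX.
    move=> [x y] [/simplex_prod_dcons[sx sy]] /= fxy; split => //; split => //.
    rewrite /g (_ : z' = y)//; apply: functional_extensionality_dep.
    by case.
  (* The probability is at most [1] and at most [u]; the former suffices when [u > 1], the latter
     when [u <= 1], where [u <= sqrt u]. *)
  rewrite -[tau * _ / _]/u; have [u1|u1] := leP u 1; last first.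
    apply: (le_trans (probability_le1 _ mg)); rewrite lee_fin.
    by rewrite -sqrtr1 ler_sqrt ?(ltW u0)// ltW.
  apply: (le_trans le_u); rewrite lee_fin -{1}(sqr_sqrtr (ltW u0)).
  by rewrite expr2 ler_piMr ?sqrtr_ge0// -sqrtr1 ler_sqrt.
pose p' i := p (lift ord0 i).
have P0 : 0 < \prod_(i < r.+1) (gamma * (p' i)%:R).
  by apply: prodr_gt0 => i _; exact/gammaM_gt0/p0.
have tP0 := ltW (mulr_gt0 tau0 P0).
have := @uniform_simplex_prodS_lt r.+1 p f z tau
  (2 ^+ r * Num.sqrt (tau * \prod_(i < r.+1) (gamma * (p' i)%:R))) p0 af sz fz0.
rewrite mulr_gt0 ?exprn_gt0 ?sqrtr_gt0 ?mulr_gt0// => /(_ isT) step.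
apply: (le_trans (step _)).
  move=> x sx fx fx0.
  have := ih p' fx (fun i => z (lift ord0 i)) (fun i => p0 _)
    (anti_concentrated_dcons _ _ _ _ _ sx af) (fun i => sz _) fx0 tau0.
  by rewrite (sqrtrM _ tP0) (sqrtrV (ltW fx0)) mulrA.
rewrite lee_fin le_eqVlt; apply/orP; left; apply/eqP.
rewrite mulrA mulrA -exprS -mulrA -(sqrtrM _ tP0).
congr (_ * Num.sqrt _); rewrite [in RHS]big_ord_recl [LHS]mulrA; congr (_ / _).
by rewrite -[LHS]mulrA; congr (_ * _); exact: mulrC.
Qed.

End small_values.

(** * Numerical comparison of the failure bound with the target *)

Section numeric_bounds.
Context {R : realType}.

(** The inequality [1 + x <= expR x] at [x = 1/8], raised to the eighth power. *)
Lemma expR1_ge : 64 / 25 <= expR 1 :> R.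
Proof.
have -> : expR 1 = expR (8^-1) ^+ 8 :> R by rewrite -expRM_natl divff.
have h : 9 / 8 <= expR (8^-1) :> R.
  by rewrite (le_trans _ (expR_ge1Dx _))//; lra.
have : (9 / 8) ^+ 8 <= expR (8^-1) ^+ 8 :> R.
  by rewrite lerXn2r// ?nnegrE ?expR_ge0//; lra.
by apply: le_trans; lra.
Qed.

(** Since [1/2 = (3/4) * (2/3)], applying [x <= - ln (1 - x)] at [1/4] and [1/3] gives
    [1/4 + 1/3]. *)
Lemma ln2_ge : 7 / 12 <= ln 2 :> R.
Proof.
have le_lnN (x : R) : 0 < x < 1 -> x <= - ln (1 - x).
  move=> /andP[x0 x1]; have := @le_ln1Dx R (- x); rewrite ltrN2 => /(_ x1).
  by rewrite lerNr.
have -> : ln 2 = - ln (1 - 4^-1) - ln (1 - 3^-1) :> R.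
  rewrite -opprD -lnM ?posrE; [|lra|lra].
  by rewrite (_ : _ * _ = 2^-1) ?lnV ?opprK ?posrE//; lra.
have := le_lnN 4^-1; have := le_lnN 3^-1; lra.
Qed.

(** The worst case is [gamma = 1] with two factors, that is [r = 0] here. There [17/25] separates
    the two sides: [1 / (expR 1 * ln 2) <= 17/25] and [2 / expR 1 ^+ 2 <= 8/25]. *)
Lemma inv_expR_ln_le r (gamma : R) : 1 <= gamma ->
  1 / (expR gamma * ln r.+2%:R) <= 1 - 2 ^+ r.+1 / expR 1 ^+ r.+2.
Proof.
move=> gamma1; have e_ge := expR1_ge; have l_ge := ln2_ge.
have h1 : 2 ^+ r.+1 / expR 1 ^+ r.+2 <= 2 / expR 1 ^+ 2 :> R.
  rewrite ler_pdivrMr ?exprn_gt0 ?expR_gt0//.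
  rewrite -[r.+2]addn2 exprD mulrA mulrAC divfK; last first.
    by rewrite expf_neq0// gt_eqF// expR_gt0.
  rewrite exprS ler_wpM2l// lerXn2r ?nnegrE ?expR_ge0//; lra.
have h2 : 2 / expR 1 ^+ 2 <= 8 / 25 :> R.
  rewrite ler_pdivrMr ?exprn_gt0 ?expR_gt0//; nra.
have h3 : 1 / (expR gamma * ln r.+2%:R) <= 1 / (expR 1 * ln 2) :> R.
  rewrite !div1r lef_pV2 ?posrE ?mulr_gt0 ?expR_gt0 ?ln_gt0 ?ltr1n//.
  rewrite ler_pM ?expR_ge0 ?ler_expR ?ln_ge0 ?ler1n//.
  by rewrite ler_ln ?posrE ?ltr0n// ler_nat.
have h4 : 1 / (expR 1 * ln 2) <= 17 / 25 :> R.
  rewrite ler_pdivrMr ?mulr_gt0 ?expR_gt0 ?ln_gt0 ?ltr1n//; nra.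
lra.
Qed.

End numeric_bounds.

(** * Passing to the complement of the small-value event *)

Theorem theorem1p2 (R : realType) (gamma : R) (r : nat) (p : 'I_r -> nat)
    (f : dprod (fun i : 'I_r => (p i).-tuple R) -> R) (OPT : R) :
  1 <= gamma ->
  gamma <= r%:R ->
  (forall i, (0 < p i)%N) ->
  anti_concentrated gamma f ->
  is_max (f @` simplex_prod p) OPT ->
  ((1 / (expR gamma * ln r%:R))%:E <=
   uniform_simplex_prod p
     (simplex_prod p `&`
      [set x | ((gamma * expR 2) ^- r * (\prod_(i < r) (1 / (p i)%:R)) * OPT
                <= f x)%R]))%E.
Proof.
move=> gamma1 gammar p0 af [[z sz fzE] _].
case: r => [|[|r]] in p f gammar p0 af z sz fzE *.
(* The case of no factors contradicts [1 <= gamma <= r]. *)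
- by have := le_trans gamma1 gammar; rewrite ler10.
- by rewrite ln1 mulr0 invr0 mulr0.
set tau := _ * _ * OPT.
have [f0 mf _] := af.
have gamma0 : 0 < gamma by rewrite (lt_le_trans ltr01).
have c0 : 0 < (gamma * expR 2) ^- r.+2 * \prod_(i < r.+2) (1 / (p i)%:R).
  rewrite mulr_gt0 ?invr_gt0 ?exprn_gt0 ?mulr_gt0 ?expR_gt0//.
  by apply: prodr_gt0 => i _; rewrite div1r invr_gt0 ltr0n.
have lhs_le := inv_expR_ln_le r _ gamma1.
have B_le : (uniform_simplex_prod p (simplex_prod p `&` [set x | (f x < tau)%R])
    <= (2 ^+ r.+1 / expR 1 ^+ r.+2)%:E)%E.
  (* If [OPT <= 0] then [tau <= 0], and the nonnegative [f] takes no value below [tau]. *)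
  have [OPT0|OPT0] := leP OPT 0.
    rewrite (_ : _ `&` _ = set0) ?measure0 ?lee_fin;
      first by rewrite divr_ge0 ?exprn_ge0 ?expR_ge0.
    apply/seteqP; split => // x [/f0 fx0] /=; apply/negP; rewrite -leNgt.
    by rewrite (le_trans _ fx0)// /tau pmulr_rle0.
  have := @uniform_simplex_prod_lt R gamma gamma1 r.+1 p f z tau p0 af sz.
  rewrite fzE OPT0 mulr_gt0// => /(_ isT isT) /le_trans; apply.
  rewrite lee_fin le_eqVlt; apply/orP; left; apply/eqP; congr (_ * _).
  (* The factors [gamma] and [p i] cancel against those in [tau], leaving [expR 2] to the power
     [- r.+2]; this is a perfect square, so the root is exact. *)
  rewrite (_ : tau * _ / OPT = ((expR 1 ^+ r.+2)^-1) ^+ 2).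
    by rewrite sqrtr_sqr ger0_norm// invr_ge0 exprn_ge0// expR_ge0.
  rewrite /tau mulrAC mulfK ?gt_eqF// -mulrA -big_split/=.
  rewrite (eq_bigr (fun=> gamma)) => [|i _]; last first.
    by rewrite mulrCA div1r mulVf ?mulr1// pnatr_eq0 -lt0n.
  rewrite prodr_const card_ord.
  have -> : expR 2 = expR 1 ^+ 2 :> R by rewrite -expRM_natl mulr1.
  rewrite exprMn invfM mulrAC mulVf ?mul1r; last first.
    by rewrite expf_neq0// gt_eqF.
  by rewrite exprVn -!exprM mulnC.
have -> : simplex_prod p `&` [set x | tau <= f x] =
    simplex_prod p `\` (simplex_prod p `&` [set x | f x < tau]).
  apply/seteqP; split => x /= [sx].
    by rewrite leNgt => /negP h; split => // -[].
  by move=> h; split => //; rewrite leNgt; apply/negP => ?; exact: h.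
have mS := @measurable_simplex_prod R _ p.
rewrite measureD//; last 2 first.
- exact: measurable_sub_lt.
- by rewrite (le_lt_trans (probability_le1 _ _)) ?ltry.
rewrite setIA setIid [X in (_ <= X - _)%E](_ : _ = 1%E); last first.
  exact: uniform_simplex_prod_simplex_prod.
rewrite leeBrDr ?fin_num_measure//; last exact: measurable_sub_lt.
apply: (le_trans (leeD (lexx _) B_le)).
by rewrite -EFinD lee_fin -lerBrDr.
Qed.
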